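(* Let $k\ge 2$ be an integer and let $x,y\in\mathbb{C}$ with $|x|\le 1$, $|y|\le 1$, $x\neq 1$, $y\neq 1$, and additionally $xy\neq 1$ if $k=2$. Then \[ \sum_{j=1}^{k-1}2^{j-1}\left(\mathrm{Li}_{k-j,j}(x^{-1}y,x)+\mathrm{Li}_{k-j,j}(xy^{-1},y)\right)+\mathrm{Li}_{1,k-1}(x^{-1},xy)+\mathrm{Li}_{1,k-1}(y^{-1},xy) =\left(\mathrm{Li}_1(x)+\mathrm{Li}_1(y)\right)\mathrm{Li}_{k-1}(xy)+(k-1)\,\mathrm{Li}_k(xy). \]
   Context: For positive integers $k_1,\dots,k_r$ the multiple polylogarithm is $\mathrm{Li}_{k_1,\ldots,k_r}(z_1,\ldots,z_r)=\sum_{0<m_1<\cdots<m_r}\frac{z_1^{m_1}\cdots z_r^{m_r}}{m_1^{k_1}\cdots m_r^{k_r}}$; in particular $\mathrm{Li}_k(z)=\sum_{m\ge1}z^m/m^k$ and $\mathrm{Li}_{k_1,k_2}(z_1,z_2)=\sum_{0<m_1<m_2}\frac{z_1^{m_1}z_2^{m_2}}{m_1^{k_1}m_2^{k_2}}$. In expressions such as $\mathrm{Li}_{k_1,k_2}(x^{-1}y,x)$ the product $z_1^{m_1}z_2^{m_2}$ is understood after simplification, e.g. $(x^{-1}y)^{m_1}x^{m_2}=y^{m_1}x^{m_2-m_1}$ and $(x^{-1})^{m_1}(xy)^{m_2}=x^{m_2-m_1}y^{m_2}$, so that all series converge under the stated hypotheses. *)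

(* Defs.v *)
From mathcomp Require Export all_boot all_order all_algebra.
From mathcomp Require Export all_classical all_reals all_analysis.
From mathcomp Require Export complex.

Set Implicit Arguments.
Unset Strict Implicit.
Unset Printing Implicit Defensive.

Export Order.TTheory GRing.Theory Num.Theory.
Export numFieldNormedType.Exports.

Global Open Scope classical_set_scope.
Global Open Scope ring_scope.

(* Laurent monomials in two indeterminates: Mono a b stands for X^a Y^b.
   The arguments of the double polylogarithms are such monomials rather than
   complex numbers: the product z1^m1 z2^m2 is simplified formally first and
   evaluated at (x, y) afterwards, so that arguments such as X^-1 Y make sense
   at x = 0 too. *)
Record monomial := Mono { degX : int; degY : int }.

Definition monX := Mono 1 0.
Definition monY := Mono 0 1.
Definition mon_mul (u v : monomial) := Mono (degX u + degX v) (degY u + degY v).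
Definition mon_inv (u : monomial) := Mono (- degX u) (- degY u).
Definition mon_exp (u : monomial) (n : nat) := Mono (degX u *+ n) (degY u *+ n).

Declare Scope monomial_scope.
Delimit Scope monomial_scope with mon.
Bind Scope monomial_scope with monomial.
Notation "u * v" := (mon_mul u v) : monomial_scope.
Notation "u ^-1" := (mon_inv u) : monomial_scope.
Notation "u ^+ n" := (mon_exp u n) : monomial_scope.

(* In every use below the total degrees are nonnegative for 0 < m1 < m2, so the
   integer powers are ordinary powers (with 0 ^ 0 = 1). *)
Definition mon_eval (R : realType) (x y : R[i]) (u : monomial) : R[i] :=
  x ^ degX u * y ^ degY u.

(* The codomain R[i]^o is R[i] with its usual topology, given by the modulus. *)
Definition Li_part (R : realType) (k : nat) (z : R[i]) (N : nat) : R[i]^o :=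
  \sum_(1 <= m < N.+1) z ^+ m / m%:R ^+ k.

Definition Li (R : realType) (k : nat) (z : R[i]) : R[i] :=
  limn (Li_part k z).

(* Outside absolute convergence, the sum over 0 < m1 < m2 is the limit of the
   sums over 0 < m1 < m2 <= N as N tends to infinity. *)
Definition Li2_part (R : realType) (x y : R[i]) (k1 k2 : nat)
    (z1 z2 : monomial) (N : nat) : R[i]^o :=
  \sum_(1 <= m2 < N.+1) \sum_(1 <= m1 < m2)
    mon_eval x y (z1 ^+ m1 * z2 ^+ m2)%mon / (m1%:R ^+ k1 * m2%:R ^+ k2).

Definition Li2 (R : realType) (x y : R[i]) (k1 k2 : nat)
    (z1 z2 : monomial) : R[i] :=
  limn (Li2_part x y k1 k2 z1 z2).

Arguments Li_part {R} k%_N z N%_N.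
Arguments Li {R} k%_N z.
Arguments Li2_part {R} x y (k1 k2)%_N (z1 z2)%_mon N%_N.
Arguments Li2 {R} x y (k1 k2)%_N (z1 z2)%_mon.

(* Main.v *)
(* Write m1 = m and m2 = m + n.  Summing the geometric progression in j and
   using 1/m - 2/(m + n) = (n - m)/(m (m + n)), the weights attached to
   y^m x^n on the left-hand side add up to
     (m^-(k-1) - n^-(k-1)) / (n - m)  if m <> n,   (k - 1) / m^k  if m = n.
   The diagonal is (k - 1) Li_k(xy).  The substitution n = m + d for m < n (and
   symmetrically for n < m) turns the first half of the off-diagonal terms into
   Li_1 Li_{k-1}(xy) and the second half into the two Li_{1,k-1}.
   This identity is exact for sums over squares m, n <= N.  The convergence is
   only conditional, so one has to compare squares with the triangles
   m + n <= N defining the series.  Abel summation in the variable whose base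
   differs from 1 bounds all differences, and all Cauchy increments, by a
   constant times H_{N+1} / (N + 1), where H is the harmonic number; this tends
   to 0 by Cesaro. *)
Require Import Defs.
From mathcomp Require Import ring zify.

Set Implicit Arguments.
Unset Strict Implicit.
Unset Printing Implicit Defensive.

(** * Abel summation and tail bounds by harmonic averages *)

Section Estimates.
Variable F : numFieldType.
Implicit Types (u v : F) (c : nat -> F).

Lemma ler_invn_exp (p b : nat) : (0 < p)%N -> (0 < b)%N ->
  (p%:R ^+ b)^-1 <= p%:R^-1 :> F.
Proof.
move=> p0 b0; rewrite lef_pV2 ?posrE ?exprn_gt0 ?ltr0n//.
by rewrite -natrX ler_nat -[leqLHS]expn1 leq_pexp2l.
Qed.

Lemma nonincreasing_invn_exp (b n : nat) : (0 < n)%N ->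
  (n.+1%:R ^+ b)^-1 <= (n%:R ^+ b)^-1 :> F.
Proof.
move=> n0; rewrite lef_pV2 ?posrE ?exprn_gt0 ?ltr0n//.
by rewrite lerXn2r ?nnegrE ?ler0n// ler_nat.
Qed.

Lemma norm_expr_le1 u n : `|u| <= 1 -> `|u ^+ n| <= 1.
Proof. by move=> u1; rewrite normrX exprn_ile1. Qed.

(** Multiplying by [1 - u] turns the sum into boundary terms plus increments of [c], whose norms
    telescope by monotonicity. The shift [s] serves inner sums over [n > m] with exponent
    [n - m]. *)
Lemma abel_bound u c (s p q : nat) : `|u| <= 1 -> u != 1 -> (s <= p)%N ->
  (forall n, (p <= n)%N -> 0 <= c n) ->
  (forall n, (p <= n)%N -> c n.+1 <= c n) ->
  `|\sum_(p <= n < q) u ^+ (n - s) * c n| <= 2 / `|1 - u| * c p.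
Proof.
move=> u1 uN1 sp c0 cS.
have nu : 0 < `|1 - u| by rewrite normr_gt0 subr_eq0 eq_sym.
case: (leqP q p) => [qp|/ltnW/subnKC<-].
  by rewrite big_geq// normr0 mulr_ge0 ?c0 ?divr_ge0.
set d := (q - p)%N.
rewrite mulrAC ler_pdivlMr// -normrM mulrC.
(* With the upper boundary term kept inside the norm, each step adds one increment of [c]; the slack
   [- c (p + d)] on the right pays for removing that term at the end. *)
have key : `|(1 - u) * (\sum_(p <= n < p + d) u ^+ (n - s) * c n)
             + u ^+ (p + d - s) * c (p + d)%N| <= 2 * c p - c (p + d)%N.
  elim: d => [|d IH].
    rewrite addn0 big_geq// mulr0 add0r normrM [X in _ * X]ger0_norm ?c0//.
    by rewrite (_ : 2 * _ - _ = c p); [rewrite ler_piMl ?c0 ?norm_expr_le1|ring].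
  rewrite addnS big_nat_recr ?leq_addr//= subSn ?(leq_trans sp)// ?leq_addr//.
  set S := \sum_(_ <= _ < _) _ in IH *.
  rewrite [X in `|X| <= _](_ : _ =
     ((1 - u) * S + u ^+ (p + d - s) * c (p + d)%N) +
     u ^+ (p + d - s).+1 * (c (p + d).+1 - c (p + d)%N)); last first.
    by rewrite exprS; ring.
  rewrite (le_trans (ler_normD _ _))//.
  rewrite [X in _ <= X](_ : _ =
     (2 * c p - c (p + d)%N) + (c (p + d)%N - c (p + d).+1));
    last by ring.
  rewrite lerD// normrM distrC [X in _ * X]ger0_norm; last first.
    by rewrite subr_ge0 cS// leq_addr.
  by rewrite ler_piMl ?norm_expr_le1// subr_ge0 cS// leq_addr.
rewrite -[X in `|X|](addrK (u ^+ (p + d - s) * c (p + d)%N)).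
rewrite (le_trans (ler_normB _ _))// -lerBrDr (le_trans key)// lerB//.
by rewrite normrM [X in _ * X]ger0_norm ?c0 ?leq_addr//
  ler_piMl ?c0 ?leq_addr ?norm_expr_le1.
Qed.

Lemma abel_bound_exp u (s p q b : nat) : `|u| <= 1 -> u != 1 ->
  (s <= p)%N -> (0 < p)%N -> (0 < b)%N ->
  `|\sum_(p <= n < q) u ^+ (n - s) / n%:R ^+ b| <= 2 / `|1 - u| / p%:R.
Proof.
move=> u1 uN1 sp p0 b0.
apply: le_trans (abel_bound (c := fun n => (n%:R ^+ b)^-1) q u1 uN1 sp _ _) _.
- by move=> n _; rewrite invr_ge0 exprn_ge0.
- by move=> n pn; rewrite nonincreasing_invn_exp// (leq_trans p0).
- by rewrite ler_wpM2l ?divr_ge0// ler_invn_exp.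
Qed.

(** The Cesaro mean of the first [N + 1] terms of the harmonic sequence; it dominates both
    [1 / (N + 1)] and [H_N / (N + 1)]. *)
Definition harmonic_avg (N : nat) : F :=
  N.+1%:R^-1 * \sum_(1 <= i < N.+2) i%:R^-1.

Lemma le_inv_harmonic_avg N : N.+1%:R^-1 <= harmonic_avg N.
Proof.
rewrite /harmonic_avg ler_peMr ?invr_ge0// big_nat_recl// invr1 lerDl.
by rewrite sumr_ge0// => i _; rewrite invr_ge0.
Qed.

Lemma sum_inv_le_harmonic_avg N :
  (\sum_(1 <= i < N.+1) i%:R^-1) / N.+1%:R <= harmonic_avg N.
Proof.
rewrite mulrC /harmonic_avg ler_wpM2l ?invr_ge0// [leRHS]big_nat_recr//= lerDl.
by rewrite invr_ge0.
Qed.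

Lemma sum_inv_consecutive_le (p q : nat) : (0 < p)%N ->
  \sum_(p <= m < q) (m%:R * m.+1%:R)^-1 <= p%:R^-1 :> F.
Proof.
move=> p0; case: (leqP q p) => [qp|pq].
  by rewrite big_geq// invr_ge0.
have -> : \sum_(p <= m < q) (m%:R * m.+1%:R)^-1 =
          \sum_(p <= m < q) ((- m.+1%:R^-1) - (- m%:R^-1)) :> F.
  rewrite !big_nat; apply: eq_bigr => m /andP[pm _].
  have m0 : m%:R != 0 :> F by rewrite pnatr_eq0 -lt0n (leq_trans p0).
  have m1 : m.+1%:R != 0 :> F by rewrite pnatr_eq0.
  by rewrite -natr1 in m1 *; field; rewrite m0 m1.
rewrite (telescope_sumr (fun m => - m%:R^-1) (ltnW pq)) opprK addrC.
by rewrite gerDl oppr_le0 invr_ge0.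
Qed.

Lemma sum_invsq_le (p q : nat) : (0 < p)%N ->
  \sum_(p <= m < q) (m%:R ^+ 2)^-1 <= 2 / p%:R :> F.
Proof.
(* From [m + 1 <= 2 m], so that the telescoping series majorizes. *)
move=> p0; apply: le_trans (_ : 2 * \sum_(p <= m < q) (m%:R * m.+1%:R)^-1 <= _).
  rewrite mulr_sumr !big_nat ler_sum// => m /andP[pm _].
  have m0 : (0 < m)%N by rewrite (leq_trans p0).
  rewrite -[2]invrK -invfM lef_pV2 ?posrE ?exprn_gt0 ?mulr_gt0 ?invr_gt0 ?ltr0n//.
  rewrite mulrC ler_pdivrMr ?ltr0n// -natrX -!natrM ler_nat; nia.
by rewrite ler_wpM2l// sum_inv_consecutive_le.
Qed.

(** The absolutely convergent case. Numerators are arbitrary bounded [w], to cover both powers and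
    bounded inner partial sums. *)
Lemma sum_abs_cauchy (w : nat -> F) (K : F) (b N N' : nat) : (1 < b)%N ->
  0 <= K -> (forall n, `|w n| <= K) -> (N <= N')%N ->
  `|\sum_(1 <= m < N'.+1) w m / m%:R ^+ b -
    \sum_(1 <= m < N.+1) w m / m%:R ^+ b| <= 2 * K * harmonic_avg N.
Proof.
move=> b1 K0 wK NN'; rewrite (big_cat_nat (n := N.+1))//= addrAC subrr add0r.
rewrite (le_trans (ler_norm_sum _ _ _))//.
apply: le_trans (_ : K * \sum_(N.+1 <= m < N'.+1) (m%:R ^+ 2)^-1 <= _).
  rewrite mulr_sumr !big_nat ler_sum// => m /andP[Nm _].
  have m0 : (0 < m)%N by rewrite (leq_trans _ Nm).
  rewrite normrM ler_pM// ger0_norm ?invr_ge0 ?exprn_ge0//.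
  rewrite lef_pV2 ?posrE ?exprn_gt0 ?ltr0n//.
  by rewrite -!natrX ler_nat leq_pexp2l.
rewrite mulrAC [2 * _ * _]mulrC ler_wpM2l//.
by rewrite (le_trans (sum_invsq_le _ _))// ler_wpM2l// le_inv_harmonic_avg.
Qed.

Lemma sum_abel_cauchy u (b N N' : nat) : (0 < b)%N ->
  `|u| <= 1 -> u != 1 -> (N <= N')%N ->
  `|\sum_(1 <= m < N'.+1) u ^+ m / m%:R ^+ b -
    \sum_(1 <= m < N.+1) u ^+ m / m%:R ^+ b| <= 2 / `|1 - u| * harmonic_avg N.
Proof.
move=> b0 u1 uN1 NN'; rewrite (big_cat_nat (n := N.+1))//= addrAC subrr add0r.
under eq_bigr => i _ do rewrite -[i in u ^+ i]subn0.
rewrite (le_trans (abel_bound_exp _ u1 uN1 _ _ b0))// ler_wpM2l ?divr_ge0//.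
exact: le_inv_harmonic_avg.
Qed.

(** * Triangular and square truncations of the double series *)

Definition double_sum u v (a b N : nat) : F :=
  \sum_(1 <= n < N.+1) \sum_(1 <= m < n)
    v ^+ m * u ^+ (n - m) / (m%:R ^+ a * n%:R ^+ b).

(** The same series with [n] now standing for the gap between the two summation indices, each of [m]
    and the gap being cut off at [N]. *)
Definition square_sum u v (a b N : nat) : F :=
  \sum_(1 <= m < N.+1) \sum_(1 <= n < N.+1)
    v ^+ m * u ^+ n / (m%:R ^+ a * (m + n)%:R ^+ b).

(** Brings the sum over the larger index inside, where Abel summation acts. A general [p] allows
    tails [N < n <= N'] as well as full triangles. *)
Lemma exchange_sum_triangle (f : nat -> nat -> F) (p q : nat) : (0 < p)%N ->
  \sum_(p <= n < q) \sum_(1 <= m < n) f m n =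
  \sum_(1 <= m < q) \sum_(maxn m.+1 p <= n < q) f m n.
Proof.
move=> p0; rewrite [LHS]big_nat.
under eq_bigr => n /andP[_ nq].
  rewrite (@big_nat_widen _ _ _ 1 n q) 1?ltnW//; over.
rewrite -[LHS]big_nat /= (exchange_big_dep_nat predT)//=.
apply: eq_bigr => m _; rewrite [RHS](big_nat_widenl _ p) ?leq_maxr//.
by rewrite [LHS]big_nat_cond [RHS]big_nat_cond; apply: eq_bigl => n; lia.
Qed.

Lemma weighted_term_le v (a m : nat) (S B : F) : `|v| <= 1 -> (0 < a)%N ->
  (0 < m)%N -> `|S| <= B -> `|v ^+ m / m%:R ^+ a * S| <= m%:R^-1 * B.
Proof.
move=> v1 a0 m0 SB; rewrite normrM ler_pM// normrM -[leRHS]mul1r ler_pM//.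
  exact: norm_expr_le1.
by rewrite ger0_norm ?invr_ge0 ?exprn_ge0// ler_invn_exp.
Qed.

(** For fixed [m], Abel summation over [n] gives at most [C / (m * max(m + 1, N + 1))]. *)
Lemma double_sum_cauchy u v (a b N N' : nat) : (0 < a)%N -> (0 < b)%N ->
  `|u| <= 1 -> u != 1 -> `|v| <= 1 -> (N <= N')%N ->
  `|double_sum u v a b N' - double_sum u v a b N| <=
    2 / `|1 - u| * 2 * harmonic_avg N.
Proof.
move=> a0 b0 u1 uN1 v1 NN'; rewrite /double_sum.
rewrite (big_cat_nat (n := N.+1))//= addrAC subrr add0r exchange_sum_triangle//.
set C := 2 / `|1 - u|; have C0 : 0 <= C by rewrite divr_ge0.
rewrite (le_trans (ler_norm_sum _ _ _))//.
apply: le_trans (_ : \sum_(1 <= m < N'.+1)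
    C * (m%:R^-1 / (maxn m.+1 N.+1)%:R) <= _).
  rewrite big_nat [leRHS]big_nat ler_sum// => m /andP[m0 _].
  under eq_bigr => n _ do rewrite invfM mulrACA.
  rewrite -mulr_sumr [leRHS]mulrCA weighted_term_le//.
  by rewrite abel_bound_exp//; lia.
rewrite -mulr_sumr -mulrA ler_wpM2l// mulr_natl mulr2n.
(* The indices [m <= N] contribute [H_N / (N + 1)] and those beyond [N] a telescoping sum below
   [1 / (N + 1)]; hence the factor 2. *)
rewrite (big_cat_nat (n := N.+1))//= lerD//.
  apply: le_trans (sum_inv_le_harmonic_avg N); rewrite mulr_suml.
  rewrite big_nat [leRHS]big_nat ler_sum// => m /andP[_ mN].
  by rewrite (maxn_idPr _).
apply: le_trans (le_inv_harmonic_avg N).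
apply: le_trans (sum_inv_consecutive_le N'.+1 (ltn0Sn N)).
rewrite big_nat [leRHS]big_nat ler_sum// => m /andP[mN _].
by rewrite (maxn_idPl _) ?invfM// ltnW.
Qed.

(** After the shift by [m], row [m] of the square exceeds the triangle by the indices
    [N < n <= N + m], an Abel tail of size [C / (N + 1)]; the weights [1 / m] then sum to [H_N]. *)
Lemma square_double_sum_le u v (a b N : nat) : (0 < a)%N -> (0 < b)%N ->
  `|u| <= 1 -> u != 1 -> `|v| <= 1 ->
  `|square_sum u v a b N - double_sum u v a b N| <=
    2 / `|1 - u| * harmonic_avg N.
Proof.
move=> a0 b0 u1 uN1 v1; rewrite /double_sum exchange_sum_triangle// -sumrB.
set C := 2 / `|1 - u|; have C0 : 0 <= C by rewrite divr_ge0.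
rewrite (le_trans (ler_norm_sum _ _ _))//.
apply: le_trans (_ : \sum_(1 <= m < N.+1) C * (m%:R^-1 / N.+1%:R) <= _).
  rewrite big_nat [leRHS]big_nat ler_sum// => m /andP[m0 mN].
  rewrite (_ : maxn m.+1 1 = m.+1); last lia.
  have -> : \sum_(1 <= n < N.+1) v ^+ m * u ^+ n / (m%:R ^+ a * (m + n)%:R ^+ b)
     = \sum_(m.+1 <= n < N.+1 + m)
         v ^+ m * u ^+ (n - m) / (m%:R ^+ a * n%:R ^+ b).
    rewrite -[m.+1]add1n big_addn addnK; apply: eq_bigr => n _.
    by rewrite addnK [(n + m)%N]addnC.
  rewrite (big_cat_nat (n := N.+1)) ?leq_addr//= addrAC subrr add0r.
  under eq_bigr => n _ do rewrite invfM mulrACA.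
  rewrite -mulr_sumr [leRHS]mulrCA weighted_term_le//.
  by rewrite abel_bound_exp//; lia.
by rewrite -mulr_sumr -mulr_suml ler_wpM2l// sum_inv_le_harmonic_avg.
Qed.

(** The product of [Li_1(u)] and [Li_a(v)], ordered by the sum [n] of the two indices [n - m] and
    [m]. *)
Definition conv_sum u v (a N : nat) : F :=
  \sum_(1 <= n < N.+1) \sum_(1 <= m < n)
    v ^+ m * u ^+ (n - m) / (m%:R ^+ a * (n - m)%:R).

(** Partial fractions give [(1/m + 1/(N+1-m)) / (N+1)], and the reflection [m -> N+1-m] identifies
    the two halves. *)
Lemma sum_inv_conv (N : nat) :
  \sum_(1 <= m < N.+1) m%:R^-1 / (N.+1 - m)%:R <= 2 * harmonic_avg N.
Proof.
have -> : \sum_(1 <= m < N.+1) m%:R^-1 / (N.+1 - m)%:R =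
  (\sum_(1 <= m < N.+1) m%:R^-1 + \sum_(1 <= m < N.+1) (N.+1 - m)%:R^-1)
    / N.+1%:R :> F.
  rewrite -big_split mulr_suml [LHS]big_nat [RHS]big_nat.
  apply: eq_bigr => m /andP[m0 mN] /=.
  have h : (N.+1)%:R = (N.+1 - m)%:R + m%:R :> F.
    by rewrite -natrD subnK// ltnW.
  have h1 : m%:R != 0 :> F by rewrite pnatr_eq0 -lt0n.
  have h2 : (N.+1 - m)%:R != 0 :> F by rewrite pnatr_eq0 -lt0n subn_gt0.
  have h3 : N.+1%:R != 0 :> F by rewrite pnatr_eq0.
  by rewrite h in h3 *; field; rewrite h1 h2 h3.
rewrite [X in _ + X]big_nat_rev /=.
have -> : \sum_(1 <= m < N.+1) (N.+1 - (1 + N.+1 - m.+1))%:R^-1 =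
          \sum_(1 <= m < N.+1) m%:R^-1 :> F.
  rewrite [LHS]big_nat [RHS]big_nat; apply: eq_bigr => m mN.
  by congr (_%:R^-1); lia.
by rewrite -mulr2n -[X in X / _]mulr_natl -mulrA ler_wpM2l// sum_inv_le_harmonic_avg.
Qed.

(** For each [m] the product has the extra terms [N + 1 - m <= n <= N], an Abel tail of size
    [C / (N + 1 - m)]; [sum_inv_conv] adds these up. *)
Lemma prod_conv_sum_le u v (a N : nat) : (0 < a)%N ->
  `|u| <= 1 -> u != 1 -> `|v| <= 1 ->
  `|(\sum_(1 <= m < N.+1) u ^+ m / m%:R ^+ 1)
     * (\sum_(1 <= m < N.+1) v ^+ m / m%:R ^+ a) - conv_sum u v a N|
  <= 2 / `|1 - u| * 2 * harmonic_avg N.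
Proof.
move=> a0 u1 uN1 v1; rewrite /conv_sum exchange_sum_triangle// mulr_sumr -sumrB.
set C := 2 / `|1 - u|; have C0 : 0 <= C by rewrite divr_ge0.
rewrite (le_trans (ler_norm_sum _ _ _))//.
apply: le_trans (_ : \sum_(1 <= m < N.+1) C * (m%:R^-1 / (N.+1 - m)%:R) <= _);
  last by rewrite -mulr_sumr -mulrA ler_wpM2l// sum_inv_conv.
rewrite big_nat [leRHS]big_nat ler_sum// => m /andP[m0 mN].
rewrite (_ : maxn m.+1 1 = (1 + m)%N); last lia.
rewrite big_addn.
under [X in _ - X]eq_bigr => n _ do
  rewrite addnK invfM mulrACA -[in X in _ * (_ / X)](expr1 n%:R).
rewrite -mulr_sumr mulrC -mulrBr [leRHS]mulrCA weighted_term_le//.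
rewrite (big_cat_nat (n := N.+1 - m)%N) ?leq_subr//=; last lia.
rewrite addrAC subrr add0r.
under eq_bigr => n _ do rewrite -[n in u ^+ n]subn0.
by rewrite abel_bound_exp//; lia.
Qed.

(** * The exact identity for sums over squares *)

Lemma sum_square_split (f : nat -> nat -> F) N :
  \sum_(1 <= m < N.+1) \sum_(1 <= n < N.+1) f m n =
  \sum_(1 <= m < N.+1) f m m +
  \sum_(1 <= n < N.+1) \sum_(1 <= m < n) (f m n + f n m).
Proof.
elim: N => [|N IH]; first by rewrite !big_geq// addr0.
rewrite [LHS]big_nat_recr//= [X in _ + X]big_nat_recr//=.
under eq_bigr => m _ do rewrite big_nat_recr//=.
rewrite big_split/= IH [in RHS]big_nat_recr//= [X in _ = _ + X]big_nat_recr//=.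
by rewrite big_split/=; ring.
Qed.

(** The sum on the right is the cofactor of [a - 2 * b] in [a ^+ (k-1) - (2 * b) ^+ (k-1)], the
    shape needed for [subrXX]. *)
Lemma sum_pow2_geom (a b : F) (k : nat) :
  \sum_(1 <= j < k) 2 ^+ (j - 1) * (a ^+ (k - j) * b ^+ j) =
  a * b * \sum_(i < k.-1) a ^+ (k.-1.-1 - i) * (2 * b) ^+ i.
Proof.
rewrite big_add1 big_mkord mulr_sumr; apply: eq_bigr => i _.
rewrite subn1/= (_ : (k - i.+1 = (k.-1.-1 - i).+1)%N); last by case: i => i /=; lia.
by rewrite exprMn !exprS; ring.
Qed.

(** The coefficient of [y ^+ m * x ^+ n] in the sum over squares; the second summand comes from the
    series with [x] and [y] exchanged. *)
Definition weight (k m n : nat) : F :=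
  \sum_(1 <= j < k) 2 ^+ (j - 1) *
    (((m%:R ^+ (k - j) * (m + n)%:R ^+ j)^-1 +
      (n%:R ^+ (k - j) * (m + n)%:R ^+ j)^-1)).

Lemma weightE (k m n : nat) : weight k m n =
  m%:R^-1 / (m + n)%:R *
    (\sum_(i < k.-1) m%:R^-1 ^+ (k.-1.-1 - i) * (2 / (m + n)%:R) ^+ i) +
  n%:R^-1 / (m + n)%:R *
    (\sum_(i < k.-1) n%:R^-1 ^+ (k.-1.-1 - i) * (2 / (m + n)%:R) ^+ i).
Proof.
rewrite -!sum_pow2_geom -big_split/=; apply: eq_bigr => j _.
by rewrite -mulrDr !invfM !exprVn.
Qed.

Lemma weightC k m n : weight k m n = weight k n m.
Proof. by rewrite !weightE addrC addnC. Qed.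

(** Here [2 / (m + m) = 1 / m], so each geometric sum has [k - 1] equal terms. *)
Lemma weight_diag k m : (0 < m)%N -> (1 < k)%N ->
  weight k m m = (k - 1)%:R / m%:R ^+ k.
Proof.
move=> m0 k1; rewrite weightE.
have m0' : m%:R != 0 :> F by rewrite pnatr_eq0 -lt0n.
have -> : 2 / (m + m)%:R = m%:R^-1 :> F.
  by rewrite addnn -mul2n natrM invfM mulrA divff ?mul1r// pnatr_eq0.
case: k k1 => [|[|k]]// _; rewrite subn1/=.
under eq_bigr => i _ do rewrite -exprD subnK -1?ltnS ?ltn_ord//.
rewrite sumr_const card_ord -mulr_natl addnn -mul2n natrM -exprVn !exprS.
by field; rewrite m0'.
Qed.

Lemma weight_lt k m n : (0 < m)%N -> (m < n)%N ->
  weight k m n = (m%:R ^+ (k - 1))^-1 / (n - m)%:R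
               - (n%:R ^+ (k - 1))^-1 / (n - m)%:R.
Proof.
move=> m0 mn; rewrite weightE.
have hn : n%:R = m%:R + (n - m)%:R :> F by rewrite -natrD subnKC// ltnW.
have h1 : m%:R != 0 :> F by rewrite pnatr_eq0 -lt0n.
have h2 : n%:R != 0 :> F by rewrite pnatr_eq0 -lt0n (leq_trans _ mn).
have h3 : (n - m)%:R != 0 :> F by rewrite pnatr_eq0 -lt0n subn_gt0.
have h4 : (m + n)%:R != 0 :> F by rewrite pnatr_eq0 -lt0n addn_gt0 m0.
have S1 := subrXX (m%:R^-1 : F) (2 / (m + n)%:R) k.-1.
have S2 := subrXX (n%:R^-1 : F) (2 / (m + n)%:R) k.-1.
set A := \sum_(i < k.-1) _ in S1 *; set B := \sum_(i < k.-1) _ in S2 *.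
(* Inserting the common power of [2 / (m + n)] makes [S1] and [S2] applicable. Their linear factors
   are [(n - m) / (m (m + n))] and [-(n - m) / (n (m + n))], so dividing by [n - m] leaves the
   prefactors of [weightE]. *)
have -> : (m%:R ^+ (k - 1))^-1 / (n - m)%:R - (n%:R ^+ (k - 1))^-1 / (n - m)%:R =
  ((m%:R^-1 ^+ k.-1 - (2 / (m + n)%:R) ^+ k.-1)
   - (n%:R^-1 ^+ k.-1 - (2 / (m + n)%:R) ^+ k.-1)) / (n - m)%:R :> F.
  by rewrite subn1 !exprVn; ring.
rewrite S1 S2.
rewrite natrD in h4 *; rewrite hn in h2 h4 *.
by field; rewrite ?h1 ?h2 ?h3 ?h4.
Qed.

Lemma square_sums_identity (k N : nat) (x y : F) : (1 < k)%N ->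
  \sum_(1 <= j < k) 2 ^+ (j - 1) *
     (square_sum x y (k - j) j N + square_sum y x (k - j) j N) =
  conv_sum x (x * y) (k - 1) N + conv_sum y (x * y) (k - 1) N
  + (k - 1)%:R * (\sum_(1 <= m < N.+1) (x * y) ^+ m / m%:R ^+ k)
  - double_sum (x * y) y 1 (k - 1) N - double_sum (x * y) x 1 (k - 1) N.
Proof.
move=> k1.
have -> : \sum_(1 <= j < k) 2 ^+ (j - 1) *
     (square_sum x y (k - j) j N + square_sum y x (k - j) j N) =
  \sum_(1 <= m < N.+1) \sum_(1 <= n < N.+1) y ^+ m * x ^+ n * weight k m n.
  transitivity (\sum_(1 <= j < k) \sum_(1 <= m < N.+1) \sum_(1 <= n < N.+1)
     y ^+ m * x ^+ n * (2 ^+ (j - 1) *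
    (((m%:R ^+ (k - j) * (m + n)%:R ^+ j)^-1 +
      (n%:R ^+ (k - j) * (m + n)%:R ^+ j)^-1)))).
    apply: eq_bigr => j _; rewrite /square_sum [X in _ + X]exchange_big/=.
    rewrite -big_split mulr_sumr; apply: eq_bigr => m _.
    rewrite -big_split mulr_sumr; apply: eq_bigr => n _ /=.
    by rewrite [(n + m)%N]addnC; ring.
  rewrite exchange_big; apply: eq_bigr => m _ /=.
  by rewrite exchange_big; apply: eq_bigr => n _ /=; rewrite mulr_sumr.
rewrite sum_square_split.
have -> : \sum_(1 <= m < N.+1) y ^+ m * x ^+ m * weight k m m =
  (k - 1)%:R * (\sum_(1 <= m < N.+1) (x * y) ^+ m / m%:R ^+ k).
  rewrite mulr_sumr [LHS]big_nat [RHS]big_nat; apply: eq_bigr => m /andP[m0 _].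
  by rewrite weight_diag// exprMn; ring.
rewrite [RHS](_ : _ =
  (k - 1)%:R * (\sum_(1 <= m < N.+1) (x * y) ^+ m / m%:R ^+ k) +
  (conv_sum x (x * y) (k - 1) N + conv_sum y (x * y) (k - 1) N +
  (- double_sum (x * y) y 1 (k - 1) N - double_sum (x * y) x 1 (k - 1) N)));
  last by ring.
congr +%R.
(* The reflection [m -> n - m] produces the denominators [n ^+ (k - 1) * (n - m)] of the second half
   of [weight_lt]. *)
have rev (z w : F) : double_sum (z * w) z 1 (k - 1) N =
  \sum_(1 <= n < N.+1) \sum_(1 <= m < n)
    z ^+ n * w ^+ m / (n%:R ^+ (k - 1) * (n - m)%:R).
  apply: eq_bigr => n _; rewrite big_nat_rev/= [LHS]big_nat [RHS]big_nat.
  apply: eq_bigr => m /andP[m0 mn].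
  rewrite (_ : (1 + n - m.+1 = n - m)%N); last lia.
  rewrite subKn ?(ltnW mn)// expr1 exprMn mulrA -exprD subnK ?(ltnW mn)//.
  by rewrite [_%:R * _]mulrC.
rewrite (rev x y) [x * y]mulrC (rev y x) [y * x]mulrC.
rewrite /conv_sum -!sumrN -!big_split; apply: eq_bigr => n _ /=.
rewrite -!sumrN -!big_split [LHS]big_nat [RHS]big_nat.
apply: eq_bigr => m /andP[m0 mn] /=.
rewrite [weight k n m]weightC weight_lt//.
(* Uses [y^m x^n = (x y)^m x^(n-m)] and its mirror image to match the numerators of [conv_sum]. *)
rewrite -[in y ^+ n](subnK (ltnW mn)) -[in x ^+ n](subnK (ltnW mn)).
by rewrite !exprD !exprMn !invfM; ring.
Qed.

End Estimates.

(** * From harmonic-average bounds to limits in the complex numbers *)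

Section ComplexLimits.
Variable R : realType.
Local Notation C := (R[i]^o).

Lemma cvg_harmonic_avg : harmonic_avg R @ \oo --> (0 : R).
Proof.
have := cesaro (@cvg_harmonic R).
rewrite (_ : arithmetic_mean harmonic = harmonic_avg R)//; apply/funext => N.
by rewrite /arithmetic_mean /harmonic_avg /= /series /= [in RHS]big_add1.
Qed.

(** Norms in [R[i]] are themselves complex, so the estimates hold there first and must be carried
    back to [R]. *)
Lemma harmonic_avgC N : harmonic_avg R[i] N = (harmonic_avg R N)%:C%C.
Proof.
rewrite /harmonic_avg rmorphM/= fmorphV rmorph_nat rmorph_sum; congr (_ * _).
by apply: eq_bigr => i _; rewrite /= fmorphV rmorph_nat.
Qed.

Lemma norm_complexi : `|'i%C| = 1 :> R[i].
Proof. by rewrite normc_def/= expr0n/= add0r expr1n sqrtr1. Qed.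

Lemma ler_norm_Im (z : R[i]) : `|complex.Im z|%:C%C <= `|z|.
Proof.
by have := normc_ge_Re (z * 'i%C); rewrite normrM norm_complexi mulr1 ReiNIm normrN.
Qed.

Lemma norm_real_complex (r : R) : `|r%:C%C| = `|r|%:C%C :> R[i].
Proof. by rewrite normc_def/= expr0n/= addr0 sqrtr_sqr. Qed.

Lemma ler_norm_ReIm (z : R[i]) :
  `|z| <= (`|complex.Re z| + `|complex.Im z|)%:C%C.
Proof.
rewrite [in leLHS](complexE z) (le_trans (ler_normD _ _))//.
by rewrite normrM norm_complexi mul1r !norm_real_complex -rmorphD.
Qed.

Lemma cvg_complex (u : nat -> C) (a b : R) :
  complex.Re (u n) @[n --> \oo] --> a -> complex.Im (u n) @[n --> \oo] --> b ->
  u @ \oo --> ((a +i* b)%C : C).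
Proof.
move=> /cvgrPdist_le ua /cvgrPdist_le ub; apply/cvgrPdist_le => e e0.
(* Positivity in [R[i]] forces [e] to be real. *)
have /andP[/eqP Ie Re0] : (complex.Im e == 0) && (0 < complex.Re e).
  by move: e0; rewrite ltcE.
near=> n.
rewrite (le_trans (ler_norm_ReIm _))// lecE /= Ie eqxx/=.
rewrite [leRHS](splitr (complex.Re e)).
have E : u n = ((complex.Re (u n)) +i* (complex.Im (u n)))%C by case: (u n).
rewrite lerD//.
- rewrite E /=.
  by near: n; apply: ua; rewrite divr_gt0.
- rewrite E /=.
  by near: n; apply: ub; rewrite divr_gt0.
Unshelve. all: by end_near. Qed.

Lemma cvg_scaled_harmonic_avg (k : R) : k * harmonic_avg R N @[N --> \oo] --> 0.
Proof.
rewrite -[0](mulr0 k); apply: cvgM; [exact: cvg_cst|exact: cvg_harmonic_avg].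
Qed.

Lemma cvg_cauchy_harmonic_avgR (u : nat -> R) (k : R) :
  (forall N N', (N <= N')%N -> `|u N' - u N| <= k * harmonic_avg R N) -> cvgn u.
Proof.
move=> uk; apply/cauchy_cvgP; apply: cauchy_exP => e e0.
have /cvgr_lt /(_ _ e0) [N _ /(_ N (leqnn N))/= hN] := cvg_scaled_harmonic_avg k.
(* The bound depends only on the smaller index, so [u N] is the centre of the Cauchy ball. *)
exists (u N); exists N => // n /= Nn; rewrite /ball/= distrC.
exact: le_lt_trans (uk _ _ Nn) hN.
Qed.

Lemma cvg0_le_harmonic_avg (u : nat -> R) (k : R) :
  (forall N, `|u N| <= k * harmonic_avg R N) -> u @ \oo --> (0 : R).
Proof.
move=> uk; apply/norm_cvg0P.
apply: (@squeeze_cvgr _ _ _ _ (fun=> 0) (fun N => k * harmonic_avg R N)).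
- by near=> N; rewrite normr_ge0 uk.
- exact: cvg_cst.
- exact: cvg_scaled_harmonic_avg.
Unshelve. all: by end_near. Qed.

Lemma norm_ReIm_le_harmonic_avg (z K : R[i]) N :
  `|z| <= K * harmonic_avg R[i] N ->
  `|complex.Re z| <= complex.Re K * harmonic_avg R N /\
  `|complex.Im z| <= complex.Re K * harmonic_avg R N.
Proof.
rewrite harmonic_avgC => zK.
have h (r : R) : r%:C%C <= `|z| -> r <= complex.Re K * harmonic_avg R N.
  move=> /le_trans/(_ zK); case: K {zK} => K1 K2.
  by rewrite lecE => /andP[_]/=; rewrite mulr0 subr0.
by split; apply: h; [exact: normc_ge_Re|exact: ler_norm_Im].
Qed.

Lemma cvg_cauchy_harmonic_avg (u : nat -> C) (K : R[i]) :
  (forall N N', (N <= N')%N ->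
    `|u N' - u N : R[i]| <= K * harmonic_avg R[i] N) -> cvgn u.
Proof.
move=> uK.
have cr : cvgn (fun n => complex.Re (u n)).
  apply: (cvg_cauchy_harmonic_avgR (k := complex.Re K)) => N N' NN'.
  by have [] := norm_ReIm_le_harmonic_avg (uK N N' NN'); rewrite raddfB.
have ci : cvgn (fun n => complex.Im (u n)).
  apply: (cvg_cauchy_harmonic_avgR (k := complex.Re K)) => N N' NN'.
  by have [_] := norm_ReIm_le_harmonic_avg (uK N N' NN'); rewrite raddfB.
exact: cvgP (cvg_complex cr ci).
Qed.

Lemma cvg_dist_le_harmonic_avg (u v : nat -> C) (l : C) (K : R[i]) :
  (forall N, `|u N - v N : R[i]| <= K * harmonic_avg R[i] N) ->
  v @ \oo --> l -> u @ \oo --> l.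
Proof.
move=> uK vl.
have d0 : (fun n => u n - v n) @ \oo --> (0 : C).
  by apply: (@cvg_complex _ 0 0);
    apply: (cvg0_le_harmonic_avg (k := complex.Re K)) => N;
    have [? ?] := norm_ReIm_le_harmonic_avg (uK N).
rewrite -[l]add0r (_ : u = (fun n => (u n - v n) + v n)).
  exact: (cvgD d0 vl).
by apply/funext => n; rewrite subrK.
Qed.

(* Type inference does not find the field structure behind [R[i]^o]. *)
Lemma cvgM_complex (u v : nat -> C) (a b : C) :
  u @ \oo --> a -> v @ \oo --> b ->
  (fun n => u n * v n : C) @ \oo --> (a * b : C).
Proof. by move=> ua vb; exact: (@cvgM R[i] _ _ _ u v a b ua vb). Qed.

End ComplexLimits.

(** * Evaluation of the simplified monomials *)

Section Monomials.
Variables (R : realType) (x y : R[i]).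

(** The degree equations hold in [int] and certify nonnegative exponents, so the value is a product
    of ordinary powers even at zero. *)
Lemma mon_evalE (u : monomial) (a b : nat) :
  degX u = a -> degY u = b -> mon_eval x y u = x ^+ a * y ^+ b.
Proof. by rewrite /mon_eval => -> ->. Qed.

Lemma Li2_part_double_sum (a b : nat) (z1 z2 : monomial) (u v : R[i]) :
  (forall m n, (m < n)%N ->
     mon_eval x y (z1 ^+ m * z2 ^+ n)%mon = v ^+ m * u ^+ (n - m)) ->
  Li2_part x y a b z1 z2 = double_sum u v a b.
Proof.
move=> zE; apply/funext => N; apply: eq_bigr => n _.
by rewrite [LHS]big_nat [RHS]big_nat; apply: eq_bigr => m /andP[_ /zE->].
Qed.

Lemma Li2_part_invXY a b :
  Li2_part x y a b (monX^-1 * monY) monX = double_sum x y a b.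
Proof.
apply: Li2_part_double_sum => m n mn.
by rewrite mulrC; apply: mon_evalE => /=; lia.
Qed.

Lemma Li2_part_XinvY a b :
  Li2_part x y a b (monX * monY^-1) monY = double_sum y x a b.
Proof.
apply: Li2_part_double_sum => m n mn.
by apply: mon_evalE => /=; lia.
Qed.

Lemma Li2_part_invX a b :
  Li2_part x y a b (monX^-1) (monX * monY) = double_sum (x * y) y a b.
Proof.
apply: Li2_part_double_sum => m n mn.
rewrite exprMn mulrCA -exprD subnKC ?(ltnW mn)//.
by apply: mon_evalE => /=; lia.
Qed.

Lemma Li2_part_invY a b :
  Li2_part x y a b (monY^-1) (monX * monY) = double_sum (x * y) x a b.
Proof.
apply: Li2_part_double_sum => m n mn.
rewrite exprMn mulrA -exprD subnKC ?(ltnW mn)//.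
by apply: mon_evalE => /=; lia.
Qed.

End Monomials.

(** * Convergence of the series and of their square truncations *)

Section Convergence.
Variable R : realType.
Implicit Types x y u v : R[i].

Lemma cvg_double_sum u v (a b : nat) : (0 < a)%N -> (0 < b)%N ->
  `|u| <= 1 -> u != 1 -> `|v| <= 1 ->
  cvgn (double_sum u v a b : nat -> R[i]^o).
Proof.
move=> a0 b0 u1 uN1 v1.
apply: (cvg_cauchy_harmonic_avg (K := 2 / `|1 - u| * 2)) => N N' NN'.
exact: double_sum_cauchy.
Qed.

(** This is the case [x * y = 1]: Abel summation now bounds the inner sums in [v] uniformly, and
    [b >= 2] makes the outer series absolutely convergent. *)
Lemma cvg_double_sum_base1 v (b : nat) : (1 < b)%N ->
  `|v| <= 1 -> v != 1 -> cvgn (double_sum 1 v 1 b : nat -> R[i]^o).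
Proof.
move=> b1 v1 vN1.
pose w n := \sum_(1 <= m < n) v ^+ (m - 0) / m%:R ^+ 1.
have wb n : `|w n| <= 2 / `|1 - v| by rewrite -[leRHS]divr1 abel_bound_exp.
apply: (cvg_cauchy_harmonic_avg (K := 2 * (2 / `|1 - v|))) => N N' NN'.
have E M : double_sum 1 v 1 b M = \sum_(1 <= n < M.+1) w n / n%:R ^+ b.
  apply: eq_bigr => n _; rewrite /w mulr_suml; apply: eq_bigr => m _.
  by rewrite expr1n mulr1 subn0 invfM mulrA.
by rewrite !E; apply: sum_abs_cauchy => //; rewrite divr_ge0.
Qed.

Lemma cvg_Li_part_abs u (b : nat) : (1 < b)%N -> `|u| <= 1 -> cvgn (Li_part b u).
Proof.
move=> b1 u1; apply: (cvg_cauchy_harmonic_avg (K := 2 * 1)) => N N' NN'.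
by apply: (sum_abs_cauchy (w := fun m => u ^+ m)) => // n; exact: norm_expr_le1.
Qed.

Lemma cvg_Li_part u (b : nat) : (0 < b)%N -> `|u| <= 1 -> u != 1 ->
  cvgn (Li_part b u).
Proof.
move=> b0 u1 uN1.
apply: (cvg_cauchy_harmonic_avg (K := 2 / `|1 - u|)) => N N' NN'.
exact: sum_abel_cauchy.
Qed.

Lemma cvg_square_sum u v (a b : nat) : (0 < a)%N -> (0 < b)%N ->
  `|u| <= 1 -> u != 1 -> `|v| <= 1 ->
  (square_sum u v a b : nat -> R[i]^o) @ \oo -->
    (limn (double_sum u v a b : nat -> R[i]^o) : R[i]^o).
Proof.
move=> a0 b0 u1 uN1 v1.
apply: (cvg_dist_le_harmonic_avg (K := 2 / `|1 - u|)); last exact: cvg_double_sum.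
by move=> N; exact: square_double_sum_le.
Qed.

Lemma cvg_conv_sum u v (a : nat) : (0 < a)%N ->
  `|u| <= 1 -> u != 1 -> `|v| <= 1 -> cvgn (Li_part a v) ->
  (conv_sum u v a : nat -> R[i]^o) @ \oo --> (Li 1 u * Li a v : R[i]^o).
Proof.
move=> a0 u1 uN1 v1 cv.
apply: (cvg_dist_le_harmonic_avg (K := 2 / `|1 - u| * 2)
  (v := fun N => Li_part 1 u N * Li_part a v N)).
  by move=> N; rewrite distrC; exact: prod_conv_sum_le.
have cu : cvgn (Li_part 1 u) by exact: cvg_Li_part.
exact: (@cvgM_complex _ _ _ (limn (Li_part 1 u)) (limn (Li_part a v)) cu cv).
Qed.

End Convergence.

Theorem theorem1p1 (R : realType) (k : nat) (x y : R[i]) :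
  (2 <= k)%N ->
  `|x| <= 1 -> `|y| <= 1 ->
  x != 1 -> y != 1 ->
  (k = 2%N -> x * y != 1) ->
  (* all the series involved converge *)
  ((forall j : nat, (1 <= j < k)%N ->
      cvgn (Li2_part x y (k - j) j (monX^-1 * monY) monX) /\
      cvgn (Li2_part x y (k - j) j (monX * monY^-1) monY)) /\
   (cvgn (Li2_part x y 1 (k - 1) (monX^-1) (monX * monY)) /\
    cvgn (Li2_part x y 1 (k - 1) (monY^-1) (monX * monY))) /\
   [/\ cvgn (Li_part 1 x), cvgn (Li_part 1 y),
       cvgn (Li_part (k - 1) (x * y)) & cvgn (Li_part k (x * y))]) /\
  (* and their sums satisfy the identity *)
  \sum_(1 <= j < k) 2 ^+ (j - 1) *
      (Li2 x y (k - j) j (monX^-1 * monY) monX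
       + Li2 x y (k - j) j (monX * monY^-1) monY)
    + Li2 x y 1 (k - 1) (monX^-1) (monX * monY)
    + Li2 x y 1 (k - 1) (monY^-1) (monX * monY)
  = (Li 1 x + Li 1 y) * Li (k - 1) (x * y) + (k - 1)%N%:R * Li k (x * y).
Proof.
move=> k2 x1 y1 xN1 yN1 xyN1.
have xy1 : `|x * y| <= 1 by rewrite normrM mulr_ile1.
have k10 : (0 < k - 1)%N by lia.
(* The exclusion of [x * y = 1] at [k = 2] leaves [k >= 3] there, hence an exponent [k - 1 >= 2]. *)
have k11 : x * y = 1 -> (1 < k - 1)%N.
  by case: (eqVneq k 2%N) => [/xyN1/eqP//|k2' _]; lia.
have cC (z : R[i]) : `|z| <= 1 -> z != 1 ->
    cvgn (double_sum (x * y) z 1 (k - 1) : nat -> R[i]^o).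
  move=> z1 zN1; case: (eqVneq (x * y) 1) => [xyE|xyN]; last first.
    exact: cvg_double_sum.
  by rewrite xyE; apply: cvg_double_sum_base1 => //; exact: k11.
have cL : cvgn (Li_part (k - 1) (x * y)).
  case: (eqVneq (x * y) 1) => [xyE|xyN]; last exact: cvg_Li_part.
  by apply: cvg_Li_part_abs => //; exact: k11.
have cLk : cvgn (Li_part k (x * y)) by exact: cvg_Li_part_abs.
split; [split; [|split]|].
- move=> j /andP[j0 jk]; rewrite Li2_part_invXY Li2_part_XinvY.
  by split; apply: cvg_double_sum => //; rewrite subn_gt0.
- by rewrite Li2_part_invX Li2_part_invY; split; exact: cC.
- by split; [exact: cvg_Li_part|exact: cvg_Li_part|exact: cL|exact: cLk].
rewrite /Li2 Li2_part_invX Li2_part_invY.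
under eq_bigr => j _ do rewrite Li2_part_invXY Li2_part_XinvY.
(* The limit of [sq] is computed twice, termwise and through [square_sums_identity]; uniqueness of
   limits gives the theorem. *)
pose sq N : R[i]^o := \sum_(1 <= j < k) 2 ^+ (j - 1) *
  (square_sum x y (k - j) j N + square_sum y x (k - j) j N).
have lim_l : sq @ \oo --> (\sum_(1 <= j < k) 2 ^+ (j - 1) *
    (limn (double_sum x y (k - j) j : nat -> R[i]^o) +
     limn (double_sum y x (k - j) j : nat -> R[i]^o)) : R[i]^o).
  (* Keeps [1 <= j < k] available, so that both exponents [k - j] and [j] are positive. *)
  rewrite /sq [X in _ --> X]big_nat; under eq_cvg do rewrite big_nat.
  apply: cvg_big => [|j /andP[j0 jk]]; first exact: add_continuous.
  apply: cvgM_complex; first exact: cvg_cst.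
  apply: cvgD; apply: cvg_square_sum => //; by rewrite subn_gt0.
have lim_r : sq @ \oo --> (Li 1 x * Li (k - 1) (x * y) +
    Li 1 y * Li (k - 1) (x * y) + (k - 1)%:R * Li k (x * y)
    - limn (double_sum (x * y) y 1 (k - 1) : nat -> R[i]^o)
    - limn (double_sum (x * y) x 1 (k - 1) : nat -> R[i]^o) : R[i]^o).
  under eq_cvg do rewrite /sq square_sums_identity//.
  apply: cvgB; last exact: cC.
  apply: cvgB; last exact: cC.
  apply: cvgD; last by apply: cvgM_complex; [exact: cvg_cst|exact: cLk].
  by apply: cvgD; [exact: (cvg_conv_sum k10 x1 xN1 xy1 cL)
                  |exact: (cvg_conv_sum k10 y1 yN1 xy1 cL)].
rewrite (cvg_unique _ lim_l lim_r); last exact: norm_hausdorff.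
by rewrite addrAC !subrK mulrDl.
Qed.
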